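(* Let $K$ be an absorptive, fully-continuous semiring. Let $\mathcal{E} \colon (X = P_X)_{X \in \mathbf{X}}$ be a polynomial equation system over $K$ and $\mathbf{X} = \{X_1,\dots,X_\ell\}$ with induced operator $F_\mathcal{E} \colon K^\ell \to K^\ell$. Then, \[ \mathrm{lfp}(F_\mathcal{E}) = F_\mathcal{E}^\ell(\mathbf{0}),\quad \mathrm{gfp}(F_\mathcal{E}) = F_\mathcal{E}^\ell\big( \, F_\mathcal{E}^\ell(\mathbf{1})^\infty \,\big). \]
   Context: A (commutative) semiring $(K,+,\cdot,0,1)$ with $0\neq 1$ is absorptive if $1+a=1$ for all $a$ (this implies idempotence). The natural order is $a \le b$ iff $a+b=b$. $K$ is fully continuous if $\le$ is a complete lattice and for all $a\in K$, all nonempty chains $C\subseteq K$ and $\circ\in\{+,\cdot\}$: $\sup(a\circ C)=a\circ\sup C$ and $\inf(a\circ C)=a\circ\inf C$ (suprema/infima w.r.t. the natural order). The infinitary power is $a^\infty := \inf_{n\in\mathbb{N}} a^n$ (infimum w.r.t. the natural order), applied componentwise to tuples. A polynomial equation system $\mathcal{E}$ over $K$ and indeterminates $\mathbf{X}=\{X_1,\dots,X_\ell\}$ is a family of equations $X_i = P_i(X_1,\dots,X_\ell)$, where each $P_i$ is a finite sum of terms $c\cdot m$ with pairwise different monomials $m$ over $\mathbf{X}$ (natural-number exponents) and coefficients $c\in K\setminus\{0\}$. The induced operator is $F_\mathcal{E}(a_1,\dots,a_\ell)_X = P_X(a_1,\dots,a_\ell)$; $\mathrm{lfp}$/$\mathrm{gfp}$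 denote its least/greatest fixed point w.r.t. the componentwise natural order, i.e. the least/greatest solution of $\mathcal{E}$. $\mathbf{0}=(0,\dots,0)$, $\mathbf{1}=(1,\dots,1)$, and $F^\ell$ is the $\ell$-fold application of $F$. *)

(* Defs.v *)
(* The library's multivariate polynomials ({mpoly R[n]}, {malg R[M]}) require a
   ring of coefficients; here [mvpoly] is a finitely supported function, so
   that the coefficients may form a semiring. *)
From HB Require Import structures.
From mathcomp Require Import all_boot all_order all_algebra finmap.
From mathcomp Require Import boolp classical_sets.

Set Implicit Arguments.
Unset Strict Implicit.
Unset Printing Implicit Defensive.

Import GRing.Theory.
Local Open Scope classical_set_scope.
Local Open Scope ring_scope.

Section Bounds.
Variables (T : choiceType) (le : rel T).

Definition is_sup (A : set T) (s : T) : Prop :=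
  (forall x, A x -> le x s) /\ (forall b, (forall x, A x -> le x b) -> le s b).

Definition is_inf (A : set T) (s : T) : Prop :=
  (forall x, A x -> le s x) /\ (forall b, (forall x, A x -> le b x) -> le b s).

Definition is_complete_lattice : Prop :=
  [/\ reflexive le, antisymmetric le, transitive le
    & forall A : set T, (exists s, is_sup A s) /\ (exists s, is_inf A s)].

End Bounds.

Section FixedPoints.
Variables (T : Type) (le : T -> T -> Prop) (F : T -> T).

Definition is_lfp (x : T) : Prop := F x = x /\ forall y, F y = y -> le x y.

Definition is_gfp (x : T) : Prop := F x = x /\ forall y, F y = y -> le y x.

End FixedPoints.

(* [0 <> 1] is part of [comNzSemiRingType]. *)
Section Semiring.
Variable K : comNzSemiRingType.

Definition nat_le : rel K := fun a b => a + b == b.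

(* The default value 0 is only taken when the bound does not exist, which is
   excluded as soon as [nat_le] is a complete lattice. *)
Definition nat_sup (A : set K) : K := xget 0 (is_sup nat_le A).
Definition nat_inf (A : set K) : K := xget 0 (is_inf nat_le A).

Definition absorptive : Prop := forall a : K, 1 + a = 1.

Definition continuous_op (op : K -> K -> K) : Prop :=
  forall (a : K) (C : set K), C !=set0 -> total_on C nat_le ->
    nat_sup [set op a c | c in C] = op a (nat_sup C) /\
    nat_inf [set op a c | c in C] = op a (nat_inf C).

Definition fully_continuous : Prop :=
  [/\ is_complete_lattice nat_le, continuous_op +%R & continuous_op *%R].

Definition inf_pow (a : K) : K := nat_inf [set a ^+ n | n in [set: nat]].

End Semiring.

Section PolynomialSystems.
Variables (K : comNzSemiRingType) (l : nat).

Definition vec_le (a b : {ffun 'I_l -> K}) : Prop :=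
  forall i, nat_le (a i) (b i).

Definition vec_inf_pow (a : {ffun 'I_l -> K}) : {ffun 'I_l -> K} :=
  [ffun i => inf_pow (a i)].

(* A monomial is its vector of exponents. *)
Definition monomial : choiceType := {ffun 'I_l -> nat}.

(* A polynomial maps each monomial to its coefficient, which is nonzero exactly
   on the finite set [finsupp p]. *)
Definition mvpoly : Type := {fsfun monomial -> K with 0}.

Definition mon_eval (m : monomial) (a : {ffun 'I_l -> K}) : K :=
  \prod_(i < l) a i ^+ m i.

Definition poly_eval (p : mvpoly) (a : {ffun 'I_l -> K}) : K :=
  \sum_(m <- finsupp p) p m * mon_eval m a.

(* The system (X_i = P i), for i < l. *)
Definition poly_system : Type := 'I_l -> mvpoly.

Definition system_op (P : poly_system) (a : {ffun 'I_l -> K}) :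
  {ffun 'I_l -> K} := [ffun i => poly_eval (P i) a].

End PolynomialSystems.

(* Main.v *)
(* Instead of derivation trees, four inequalities satisfied by every polynomial
   operator F are used: monotonicity; F(y + c x) <= F(y) + c F(x) for y <= x;
   F(x) c <= F(x c) for c idempotent; and F(x)^oo <= F(x^oo).  Freezing the
   values of the variables in a set S, one inducts on the number of free
   variables.  For the least fixed point, the second inequality with x = 1 shows
   that freezing one more variable costs only an additive constant.  Let N be
   the greatest fixed point.  The third and fourth inequalities give
   F^l(1)^oo <= N, hence v := F^l(1)^oo = N^oo is a postfixed point.  The first
   part, applied to v + F, makes F^l(v) a fixed point, and the second inequality
   shows that every fixed point above N^oo is above N: the equation of a variable
   j gives N_j <= w_j + N_j q, which iterates to N_j <= w_j + q^oo, where q^oo,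
   the weight of recurring through j for ever, is below N_j and hence below
   N_j^oo <= w_j. *)
Require Import Defs.
From mathcomp Require Import all_boot all_order all_algebra finmap.
From mathcomp Require Import boolp classical_sets.

Set Implicit Arguments.
Unset Strict Implicit.
Unset Printing Implicit Defensive.

Import GRing.Theory.
Local Open Scope ring_scope.

Local Notation "x <~ y" := (nat_le x y) (at level 70, no associativity).

(** * The natural order and infinitary powers *)

Section AbsorptiveOrder.
Variable K : comNzSemiRingType.
Hypothesis K_absorptive : absorptive K.
Implicit Types a b c : K.

Lemma addrr_absorptive a : a + a = a.
Proof. by rewrite -[a in a + _]mulr1 -[a in _ + a]mulr1 -mulrDr K_absorptive mulr1. Qed.

Lemma nat_le_refl a : a <~ a.
Proof. by apply/eqP; exact: addrr_absorptive. Qed.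

Lemma nat_le_trans b a c : a <~ b -> b <~ c -> a <~ c.
Proof. by move=> /eqP ab /eqP bc; apply/eqP; rewrite -bc addrA ab. Qed.

Lemma nat_le_anti a b : a <~ b -> b <~ a -> a = b.
Proof. by move=> /eqP ab /eqP ba; rewrite -ba addrC ab. Qed.

Lemma nat_le0 a : 0 <~ a.
Proof. by apply/eqP; rewrite add0r. Qed.

Lemma nat_le1 a : a <~ 1.
Proof. by apply/eqP; rewrite addrC K_absorptive. Qed.

Lemma nat_leDl a b : a <~ a + b.
Proof. by apply/eqP; rewrite addrA addrr_absorptive. Qed.

Lemma nat_leDr a b : a <~ b + a.
Proof. by rewrite addrC; exact: nat_leDl. Qed.

Lemma nat_leU a b c : a <~ c -> b <~ c -> a + b <~ c.
Proof. by move=> /eqP ac /eqP bc; apply/eqP; rewrite -addrA bc. Qed.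

Lemma nat_leD a b c d : a <~ b -> c <~ d -> a + c <~ b + d.
Proof. by move=> /eqP ab /eqP cd; apply/eqP; rewrite addrACA ab cd. Qed.

Lemma nat_leM a b c d : a <~ b -> c <~ d -> a * c <~ b * d.
Proof.
move=> ab cd; apply: (@nat_le_trans (b * c)).
  by move/eqP: ab => ab; apply/eqP; rewrite -mulrDl ab.
by move/eqP: cd => cd; apply/eqP; rewrite -mulrDr cd.
Qed.

Lemma nat_leMl a b : a * b <~ a.
Proof. by rewrite -[X in _ <~ X]mulr1; exact: (nat_leM (nat_le_refl a) (nat_le1 b)). Qed.

Lemma nat_leMr a b : a * b <~ b.
Proof. by rewrite mulrC; exact: nat_leMl. Qed.

Lemma nat_le_pow a m n : (m <= n)%N -> a ^+ n <~ a ^+ m.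
Proof. by move=> mn; rewrite -(subnKC mn) exprD; exact: nat_leMl. Qed.

(** Each term of the binomial expansion contains a factor [a ^+ m] or [b ^+ n], and absorption
    removes the rest. *)
Lemma nat_leXD a b m n : (a + b) ^+ (m + n) <~ a ^+ m + b ^+ n.
Proof.
elim: m n => [|m IHm] n; first by rewrite expr0 K_absorptive; exact: nat_le1.
elim: n => [|n IHn]; first by rewrite expr0 [X in _ <~ X]addrC K_absorptive; exact: nat_le1.
rewrite addSn exprS mulrDl; apply: nat_leU.
  apply: (nat_le_trans (nat_leM (nat_le_refl a) (IHm n.+1))).
  by rewrite mulrDr -exprS; apply: nat_leD (nat_le_refl _) (nat_leMr _ _).
rewrite addnS -addSn.
apply: (nat_le_trans (nat_leM (nat_le_refl b) IHn)).
by rewrite mulrDr -exprS; apply: nat_leD (nat_leMr _ _) (nat_le_refl _).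
Qed.

Hypothesis K_continuous : fully_continuous K.

Lemma nat_supP (A : set K) : is_sup (@nat_le K) A (nat_sup A).
Proof.
have [[_ _ _ /(_ A)[ex _]] _ _] := K_continuous.
exact: (xgetPex 0 ex).
Qed.

Lemma nat_infP (A : set K) : is_inf (@nat_le K) A (nat_inf A).
Proof.
have [[_ _ _ /(_ A)[_ ex]] _ _] := K_continuous.
exact: (xgetPex 0 ex).
Qed.

Definition nat_meet a b : K := nat_inf [set x | x = a \/ x = b]%classic.

Lemma nat_meetl a b : nat_meet a b <~ a.
Proof. by apply: (nat_infP _).1; left. Qed.

Lemma nat_meetr a b : nat_meet a b <~ b.
Proof. by apply: (nat_infP _).1; right. Qed.

Lemma nat_le_meet a b c : c <~ a -> c <~ b -> c <~ nat_meet a b.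
Proof. by move=> ca cb; apply: (nat_infP _).2 => x [] ->. Qed.

Lemma inf_pow_le a n : inf_pow a <~ a ^+ n.
Proof. by apply: (nat_infP _).1; exists n. Qed.

Lemma inf_pow_le1 a : inf_pow a <~ a.
Proof. exact: inf_pow_le a 1%N. Qed.

Lemma le_inf_pow a b : (forall n, b <~ a ^+ n) -> b <~ inf_pow a.
Proof. by move=> h; apply: (nat_infP _).2 => _ [n _ <-]. Qed.

Lemma inf_pow_mono a b : a <~ b -> inf_pow a <~ inf_pow b.
Proof.
move=> ab; apply: le_inf_pow => n; apply: (@nat_le_trans (a ^+ n)).
  exact: inf_pow_le.
elim: n => [|n IH]; first exact: nat_le_refl.
by rewrite !exprS; exact: nat_leM.
Qed.

Lemma le_op_inf_pow op a b c : continuous_op op ->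
  (forall n, c <~ op b (a ^+ n)) -> c <~ op b (inf_pow a).
Proof.
move=> op_cont h.
have ne : ([set a ^+ n | n in [set: nat]] !=set0)%classic by exists (a ^+ 0), 0%N.
have tot : total_on [set a ^+ n | n in [set: nat]]%classic (@nat_le K).
  move=> _ _ [m _ <-] [n _ <-]; case/orP: (leq_total m n) => ?.
    by right; exact: nat_le_pow.
  by left; exact: nat_le_pow.
have [_ <-] := op_cont b _ ne tot.
by apply: (nat_infP _).2 => _ [_ [n _ <-] <-].
Qed.

(** Continuity handles one argument at a time and produces independent exponents m and n. As powers
    decrease, the diagonal exponent [maxn m n] suffices. *)
Lemma le_op_inf_pow2 op a b c : continuous_op op -> commutative op ->
    (forall x y z, x <~ y -> op z x <~ op z y) ->
  (forall n, c <~ op (a ^+ n) (b ^+ n)) -> c <~ op (inf_pow a) (inf_pow b).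
Proof.
move=> op_cont opC op_mono h.
apply: le_op_inf_pow => // n; rewrite opC; apply: le_op_inf_pow => // m.
apply: (nat_le_trans (h (maxn m n))).
apply: (@nat_le_trans (op (a ^+ maxn m n) (b ^+ n))).
  by apply: op_mono; apply: nat_le_pow; exact: leq_maxr.
rewrite ![op _ (b ^+ n)]opC.
by apply: op_mono; apply: nat_le_pow; exact: leq_maxl.
Qed.

Lemma le_mul_inf_pow a b c :
  (forall n, c <~ a ^+ n * b ^+ n) -> c <~ inf_pow a * inf_pow b.
Proof.
have [_ _ contM] := K_continuous.
apply: le_op_inf_pow2 => //; first exact: mulrC.
by move=> x y z; exact: nat_leM (nat_le_refl z).
Qed.

Lemma inf_powM a b : inf_pow (a * b) <~ inf_pow a * inf_pow b.
Proof. by apply: le_mul_inf_pow => n; rewrite -exprMn; exact: inf_pow_le. Qed.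

Lemma inf_powD a b : inf_pow (a + b) <~ inf_pow a + inf_pow b.
Proof.
have [_ contD _] := K_continuous.
apply: le_op_inf_pow2 => //; first exact: addrC.
  by move=> x y z; exact: nat_leD (nat_le_refl z).
by move=> n; apply: (nat_le_trans _ (nat_leXD _ _ _ _)); exact: inf_pow_le.
Qed.

Lemma inf_pow_idem a : inf_pow a * inf_pow a = inf_pow a.
Proof.
apply: nat_le_anti; first exact: nat_leMl.
by apply: le_mul_inf_pow => n; rewrite -exprD; exact: inf_pow_le.
Qed.

Lemma inf_powK a : inf_pow (inf_pow a) = inf_pow a.
Proof.
apply: nat_le_anti; first exact: inf_pow_le1.
apply: le_inf_pow; elim=> [|n IH]; first exact: nat_le1.
by rewrite exprS -{1}inf_pow_idem; exact: nat_leM (nat_le_refl _) IH.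
Qed.

(** Substituting the inequality into itself gives a <= b + a q^n for every n; the infimum over n
    then passes through the sum. *)
Lemma le_add_mul_inf_pow a b q : a <~ b + a * q -> a <~ b + inf_pow q.
Proof.
move=> h; have [_ contD _] := K_continuous.
apply: le_op_inf_pow => // n.
apply: (@nat_le_trans (b + a * q ^+ n)); last first.
  exact: nat_leD (nat_le_refl b) (nat_leMr _ _).
elim: n => [|n IH]; first by rewrite mulr1; exact: nat_leDr.
apply: (nat_le_trans IH); apply: nat_leU; first exact: nat_leDl.
apply: (nat_le_trans (nat_leM h (nat_le_refl _))).
by rewrite mulrDl -mulrA -exprS; apply: nat_leD (nat_leMl _ _) (nat_le_refl _).
Qed.

End AbsorptiveOrder.

(** * Inequalities satisfied by polynomial operators *)

Section PolynomialRelation.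
Variables (K : comNzSemiRingType) (l : nat) (R : K -> K -> K -> Prop).
Hypothesis R_diag : forall a, R a a a.
Hypothesis R_add : forall a b c a' b' c',
  R a b c -> R a' b' c' -> R (a + a') (b + b') (c + c').
Hypothesis R_mul : forall a b c a' b' c',
  R a b c -> R a' b' c' -> R (a * a') (b * b') (c * c').

(* A subsemiring of K * K * K that contains the diagonal is preserved by
   polynomials; every inequality on polynomials below is an instance. *)
Lemma poly_eval_rel (p : mvpoly K l) (x y z : {ffun 'I_l -> K}) :
    (forall i, R (x i) (y i) (z i)) ->
  R (poly_eval p x) (poly_eval p y) (poly_eval p z).
Proof.
move=> Rxyz; apply: (big_rec3 R) => // m a b c _ Rabc.
apply: R_add => //; apply: R_mul => //.
apply: (big_rec3 R) => // i a' b' c' _ R'; apply: R_mul => //.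
by elim: (m i) => [|n IH] //; rewrite !exprS; exact: R_mul.
Qed.

End PolynomialRelation.

Section PolynomialInequalities.
Variables (K : comNzSemiRingType) (l : nat) (E : poly_system K l).
Hypothesis K_absorptive : absorptive K.
Implicit Types (c : K) (x y : {ffun 'I_l -> K}).

Lemma system_op_mono x y :
  vec_le x y -> vec_le (system_op E x) (system_op E y).
Proof.
move=> xy i; rewrite !ffunE.
apply: (@poly_eval_rel _ _ (fun a b _ => a <~ b) _ _ _ _ x y y) => //.
- exact: nat_le_refl.
- by move=> a b _ a' b' _; exact: nat_leD.
- by move=> a b _ a' b' _; exact: nat_leM.
Qed.

Lemma system_op_affine c x y i : vec_le y x ->
  system_op E [ffun k => y k + c * x k] i
    <~ system_op E y i + c * system_op E x i.
Proof.
move=> yx; rewrite !ffunE.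
set z := [ffun k => _].
(* The relation also has to carry y <= x: in a product, the cross terms a c b' and c b a' lie below
   c b b' only because a <= b and a' <= b'. *)
suff [] : poly_eval (E i) y <~ poly_eval (E i) x /\
  poly_eval (E i) z <~ poly_eval (E i) y + c * poly_eval (E i) x by [].
apply: (@poly_eval_rel _ _ (fun a b d => a <~ b /\ d <~ a + c * b)).
- by move=> a; split; [exact: nat_le_refl | exact: nat_leDl].
- move=> a b d a' b' d' [ab dab] [ab' dab']; split; first exact: nat_leD.
  by rewrite mulrDr addrACA; exact: nat_leD.
- move=> a b d a' b' d' [ab dab] [ab' dab']; split; first exact: nat_leM.
  apply: (nat_le_trans (nat_leM dab dab')).
  rewrite mulrDl !mulrDr -addrA; apply: nat_leD; first exact: nat_le_refl.
  have cb t : t <~ b * b' -> c * t <~ c * (b * b').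
    by apply: nat_leM; exact: nat_le_refl.
  apply: nat_leU; first by rewrite mulrCA; apply/cb/nat_leM/nat_le_refl.
  apply: nat_leU; first by rewrite -mulrA; apply/cb/nat_leM => //; exact: nat_le_refl.
  rewrite -mulrA; apply: cb; apply: nat_leM; first exact: nat_le_refl.
  exact: nat_leMr.
- by move=> k; rewrite ffunE; split=> //; exact: nat_le_refl.
Qed.

(** Idempotence gives each factor of a product its own copy of [c], and coefficients absorb
    theirs. *)
Lemma system_op_scale c x i : c * c = c ->
  system_op E x i * c <~ system_op E [ffun k => x k * c] i.
Proof.
move=> cc; rewrite !ffunE.
apply: (@poly_eval_rel _ _ (fun a b _ => a * c <~ b) _ _ _ _ x _ x).
- by move=> a; exact: nat_leMl.
- by move=> a b _ a' b' _ h h'; rewrite mulrDl; exact: nat_leD.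
- by move=> a b _ a' b' _ h h'; rewrite -cc mulrACA; exact: nat_leM.
- by move=> k; rewrite ffunE; exact: nat_le_refl.
Qed.

Lemma system_op_inf_pow (K_continuous : fully_continuous K) x i :
  inf_pow (system_op E x i) <~ system_op E (vec_inf_pow x) i.
Proof.
rewrite !ffunE.
apply: (@poly_eval_rel _ _ (fun a b _ => inf_pow a <~ b) _ _ _ _ x _ x).
- exact: inf_pow_le1.
- move=> a b _ a' b' _ h h'.
  by apply: (nat_le_trans (inf_powD _ _ _ _)) => //; exact: nat_leD.
- move=> a b _ a' b' _ h h'.
  by apply: (nat_le_trans (inf_powM _ _ _ _)) => //; exact: nat_leM.
- by move=> k; rewrite ffunE; exact: nat_le_refl.
Qed.

End PolynomialInequalities.

(** * Systems with frozen variables *)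

Section FrozenSystems.
Variables (K : comNzSemiRingType) (l : nat).
Local Notation V := {ffun 'I_l -> K}.
Implicit Types (S T : {set 'I_l}) (F : V -> V) (b x y : V).

(** Frozen variables stay as coordinates, so that iterates for different frozen sets live in the
    same space and can be compared. *)
Definition freeze S b F x : V := [ffun k => if k \in S then b k else F x k].

Lemma freeze0 b F : freeze finset.set0 b F = F.
Proof. by apply/funext => x; apply/ffunP => k; rewrite ffunE finset.in_set0. Qed.

Lemma card_free_ltn S j : j \notin S -> (#|~: (j |: S)| < #|~: S|)%N.
Proof.
move=> jS; apply/proper_card/properP; split.
  by rewrite finset.setCS; exact: finset.subsetUr.
by exists j; rewrite !finset.inE ?eqxx.
Qed.

Lemma mem_free0 S k : (#|~: S| <= 0)%N -> k \in S.
Proof.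
rewrite leqn0 finset.cards_eq0 => /eqP S0; apply/negPn/negP => kS.
by have := finset.in_set0 k; rewrite -S0 finset.inE kS.
Qed.

Lemma card_free_set0 : #|~: (finset.set0 : {set 'I_l})| = l.
Proof. by rewrite finset.setC0 finset.cardsT card_ord. Qed.

Hypothesis K_absorptive : absorptive K.
Variable F : V -> V.
Hypothesis F_mono : forall x y, vec_le x y -> vec_le (F x) (F y).

(** Serves to compare frozen sets that differ by one variable, frozen at 0 on the smaller side or at
    1 on the larger side. *)
Lemma freeze_iter_mono S T b b' x x' n :
    vec_le b b' -> vec_le x x' ->
    (forall k, k \in S -> k \notin T -> forall z, b k <~ F z k) ->
    (forall k, k \notin S -> k \in T -> forall z, F z k <~ b' k) ->
  vec_le (iter n (freeze S b F) x) (iter n (freeze T b' F) x').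
Proof.
move=> bb' xx' ST TS; elim: n => [|n IH] //= k; rewrite !ffunE.
have [kS|kS] := boolP (k \in S); have [kT|kT] := boolP (k \in T) => //.
- exact: ST.
- exact: TS.
- exact: F_mono.
Qed.

Lemma iter_mono x y n : vec_le x y -> vec_le (iter n F x) (iter n F y).
Proof. by move=> xy; elim: n => [|n IH] //=; exact: F_mono. Qed.

(** * The least fixed point *)

Section LeastFixedPoint.
Hypothesis F_nonexpansive : forall c x i, F [ffun k => x k + c] i <~ F x i + c.

(* With [z] the iterate of the system in which [j] is frozen as well and
   [c = F z j], the vector [z + c] is a prefixed point. *)
Lemma freeze_iter_lfp m S : (#|~: S| <= m)%N -> forall n,
  vec_le (iter n (freeze S [ffun=> 0] F) [ffun=> 0])
         (iter m (freeze S [ffun=> 0] F) [ffun=> 0]).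
Proof.
have frozen T p i : i \in T -> iter p (freeze T [ffun=> 0] F) [ffun=> 0] i = 0.
  by case: p => [|p] iT /=; rewrite !ffunE ?iT.
elim: m S => [|m IHm] S hS n j.
  by rewrite !frozen; [exact: nat_le_refl| exact: mem_free0..].
have [jS|jS] := boolP (j \in S); first by rewrite !frozen //; exact: nat_le_refl.
have hS' := leq_trans (card_free_ltn jS) hS.
set z := iter m (freeze (j |: S) [ffun=> 0] F) [ffun=> 0].
suff le_zc : vec_le (iter n (freeze S [ffun=> 0] F) [ffun=> 0])
                    [ffun k => z k + F z j].
  (* As [z] vanishes at [j], the bound there is [F z j]: one application of [F] on top of [m]
     iterations, hence [m.+1]. *)
  apply: (nat_le_trans (le_zc j)).
  rewrite ffunE {1}/z frozen ?finset.setU11 // add0r /= ffunE (negPf jS).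
  apply: F_mono; apply: freeze_iter_mono => [k|k|k|k].
  - exact: nat_le_refl.
  - exact: nat_le_refl.
  - by move=> _ _ x; rewrite ffunE; exact: nat_le0.
  - by rewrite finset.in_setU1 negb_or => /andP[_ /negPf->].
elim: n => [|n IHn] k /=; rewrite !ffunE; first exact: nat_le0.
case: ifPn => kS; first exact: nat_le0.
apply: (nat_le_trans (F_mono IHn k)); apply: (nat_le_trans (F_nonexpansive _ _ _)).
have [->|kj] := eqVneq k j.
  by rewrite addrr_absorptive //; exact: nat_leDr.
apply: nat_leD; last exact: nat_le_refl.
(* Taken at [m.+1], the induction hypothesis says that [z] is prefixed in the free coordinates. *)
have := IHm _ hS' m.+1 k.
by rewrite /= ffunE finset.in_setU1 (negPf kj) (negPf kS).
Qed.

(** [F] is abstract here because the greatest fixed point needs this bound for v + F as well. *)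
Lemma iter_lfp n : vec_le (iter n F [ffun=> 0]) (iter l F [ffun=> 0]).
Proof.
have := @freeze_iter_lfp l finset.set0 _ n.
by rewrite card_free_set0 leqnn freeze0; exact.
Qed.

End LeastFixedPoint.

(** * The greatest fixed point *)

Section GreatestFixedPoint.
Hypothesis K_continuous : fully_continuous K.
Hypothesis F_affine : forall c x y i, vec_le y x ->
  F [ffun k => y k + c * x k] i <~ F y i + c * F x i.
Hypothesis F_scale : forall c x i, c * c = c ->
  F x i * c <~ F [ffun k => x k * c] i.
Hypothesis F_inf_pow : forall x i, inf_pow (F x i) <~ F (vec_inf_pow x) i.

Record freeze_gfp S b (g : V) : Prop := FreezeGfp {
  freeze_gfp_frozen : forall k, k \in S -> g k = b k;
  freeze_gfp_free : forall k, k \notin S -> g k = F g k;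
  freeze_gfp_max : forall y, (forall k, k \in S -> y k <~ b k) ->
    (forall k, k \notin S -> y k <~ F y k) -> vec_le y g }.

(** Knaster-Tarski: in the free coordinates, take the supremum of all postfixed points. *)
Lemma freeze_gfp_exists S b : exists g, freeze_gfp S b g.
Proof.
pose post y := (forall k, k \in S -> y k <~ b k) /\
  (forall k, k \notin S -> y k <~ F y k).
pose g : V := [ffun k => if k \in S then b k
  else nat_sup [set z | exists2 y, post y & z = y k]%classic].
have post_le y : post y -> vec_le y g.
  move=> py k; rewrite ffunE; case: ifPn => kS; first exact: py.1.
  by apply: (nat_supP K_continuous _).1; exists y.
have gF k : k \notin S -> g k <~ F g k.
  move=> kS; rewrite {1}ffunE (negPf kS).
  apply: (nat_supP K_continuous _).2 => _ [y py ->].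
  by apply: (nat_le_trans (py.2 _ kS)); apply: F_mono; exact: post_le.
exists g; split=> [k kS|k kS|y yb yF]; last exact: post_le.
  by rewrite ffunE kS.
apply: nat_le_anti; first exact: gF.
have g_le : vec_le g (freeze S b F g).
  move=> i; rewrite [freeze _ _ _ _ _]ffunE; case: ifPn => iS; last exact: gF.
  by rewrite ffunE iS; exact: nat_le_refl.
have -> : F g k = freeze S b F g k by rewrite ffunE (negPf kS).
apply: post_le; split=> i iS; rewrite ffunE ?iS ?(negPf iS).
  exact: nat_le_refl.
exact: F_mono.
Qed.

(* [F g j] bounds one unfolding of [j] down to the next occurrences of [j], so
   its infinitary power is the weight of recurring through [j] for ever. *)
Lemma freeze_gfp_return S b b' j N g : j \notin S ->
    (forall k, k \in S -> b' k = b k) -> b' j = 1 ->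
    freeze_gfp S b N -> freeze_gfp (j |: S) b' g ->
  inf_pow (F g j) <~ N j.
Proof.
move=> jS b'b b'j [_ _ N_max] [g_frozen g_free _].
set c := inf_pow _.
have cc : c * c = c by exact: inf_pow_idem.
pose y : V := [ffun k => if k \in S then b k else g k * c].
have gj : g j = 1 by rewrite g_frozen ?finset.setU11.
suff : y j <~ N j by rewrite ffunE (negPf jS) gj mul1r.
apply: N_max => k kS; rewrite ffunE ?kS ?(negPf kS); first exact: nat_le_refl.
apply: (@nat_le_trans _ (F [ffun k => g k * c] k)); last first.
  apply: F_mono => i; rewrite !ffunE; case: ifPn => iS; last exact: nat_le_refl.
  by rewrite g_frozen ?finset.in_setU1 ?iS ?orbT // b'b //; exact: nat_leMl.
apply: nat_le_trans (F_scale _ _ cc).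
(* At [j], where [g] need not solve the equation, c = c c <= F(g)_j c takes its place. *)
have [->|kj] := eqVneq k j; last first.
  by rewrite [g k]g_free ?finset.in_setU1 ?negb_or ?kj //; exact: nat_le_refl.
rewrite gj mul1r -{1}cc; apply: nat_leM; last exact: nat_le_refl.
exact: inf_pow_le1.
Qed.

(** An infinitary power counts twice, by [inf_powK]: one copy moves inside [F], where the induction
    hypothesis bounds the iterate by [g]; the other turns [F g j] into the weight of
    [freeze_gfp_return]. *)
Lemma freeze_iter_inf_pow m S N : (#|~: S| <= m)%N ->
    freeze_gfp S [ffun=> 1] N ->
  vec_le (vec_inf_pow (iter m (freeze S [ffun=> 1] F) [ffun=> 1])) N.
Proof.
have one_frozen T i N' : i \in T -> freeze_gfp T [ffun=> 1] N' -> N' i = 1.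
  by move=> iT [-> // _ _]; rewrite ffunE.
elim: m S N => [|m IHm] S N hS gfpN j.
  by rewrite (one_frozen S j N) ?mem_free0 //; exact: nat_le1.
have [jS|jS] := boolP (j \in S).
  by rewrite (one_frozen S j N) //; exact: nat_le1.
have hS' := leq_trans (card_free_ltn jS) hS.
have [g gfpg] := freeze_gfp_exists (j |: S) [ffun=> 1].
apply: nat_le_trans (freeze_gfp_return jS _ _ gfpN gfpg) => //; last by rewrite ffunE.
rewrite ffunE /= ffunE (negPf jS) -inf_powK //; apply: inf_pow_mono => //.
apply: (nat_le_trans (F_inf_pow _ _)); apply: F_mono => k.
apply: nat_le_trans (IHm _ _ hS' gfpg k).
rewrite !ffunE; apply: inf_pow_mono => //.
apply: freeze_iter_mono => [i|i|i|i].
- exact: nat_le_refl.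
- exact: nat_le_refl.
- by move=> iS; rewrite finset.in_setU1 iS orbT.
- by move=> _ _ x; rewrite ffunE; exact: nat_le1.
Qed.

(* [w + N j * g], with [g] the greatest solution for [j] frozen at 1, is
   prefixed when [j] is frozen at [N j]; the meet with [N] keeps it below [N]. *)
Lemma freeze_gfp_le m S N w : (#|~: S| <= m)%N -> freeze_gfp S N N ->
    vec_le w N -> (forall k, k \in S -> N k <~ w k) ->
    (forall k, k \notin S -> F w k <~ w k) ->
    (forall k, inf_pow (N k) <~ w k) ->
  vec_le N w.
Proof.
elim: m S w => [|m IHm] S w hS gfpN wN Nw wF powN j.
  by apply: Nw; exact: mem_free0.
have [jS|jS] := boolP (j \in S); first exact: Nw.
have hS' := leq_trans (card_free_ltn jS) hS.
have [_ N_free N_max] := gfpN.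
pose b' : V := [ffun k => if k == j then 1 else N k].
have b'j : b' j = 1 by rewrite ffunE eqxx.
have b'S k : k \in S -> b' k = N k.
  by move=> kS; rewrite ffunE; case: eqP kS jS => // -> ->.
have [g gfpg] := freeze_gfp_exists (j |: S) b'.
have [g_frozen g_free g_max] := gfpg.
have powg : inf_pow (F g j) <~ w j.
  rewrite -inf_powK //; apply: nat_le_trans (powN j); apply: inf_pow_mono => //.
  exact: freeze_gfp_return b'S b'j gfpN gfpg.
have wg : vec_le w g.
  move=> k; apply: (nat_le_trans (wN k)); apply: g_max => i iS; last first.
    by rewrite -N_free; [exact: nat_le_refl|
      apply: contra iS => iS; rewrite finset.in_setU1 iS orbT].
  by rewrite ffunE; case: eqP => _; [exact: nat_le1|exact: nat_le_refl].
pose u : V := [ffun k => w k + N j * g k].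
have Nu : vec_le N u.
  pose w' : V := [ffun k => nat_meet (N k) (u k)].
  suff Nw' : vec_le N w'.
    by move=> k; apply: (nat_le_trans (Nw' k)); rewrite ffunE; exact: nat_meetr.
  have w'N : vec_le w' N by move=> k; rewrite ffunE; exact: nat_meetl.
  have w'u : vec_le w' u by move=> k; rewrite ffunE; exact: nat_meetr.
  apply: (IHm (j |: S)) => // [|k|k|k].
  - split=> // [k|y yN yF k].
      by rewrite finset.in_setU1 negb_or => /andP[_]; exact: N_free.
    (* [y] alone need not be postfixed at [j], but y + N is: there y <= N <= F(y + N). *)
    apply: (@nat_le_trans _ ([ffun k => y k + N k] k)).
      by rewrite ffunE; exact: nat_leDl.
    apply: N_max => i iS; rewrite ffunE.
      apply: nat_leU; last exact: nat_le_refl.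
      by apply: yN; rewrite finset.in_setU1 iS orbT.
    have NF : N i <~ F [ffun k => y k + N k] i.
      rewrite (N_free i) //; apply: F_mono => t; rewrite ffunE; exact: nat_leDr.
    apply: nat_leU => //.
    have [ij|ij] := eqVneq i j.
      apply: nat_le_trans NF; apply: yN.
      by rewrite ij finset.setU11.
    apply: (@nat_le_trans _ (F y i)).
      by apply: yF; rewrite finset.in_setU1 negb_or ij.
    by apply: F_mono => t; rewrite ffunE; exact: nat_leDl.
  - move=> kS; rewrite ffunE; apply: nat_le_meet => //; first exact: nat_le_refl.
    rewrite ffunE; case/finset.setU1P: kS => [->|kS].
      rewrite g_frozen ?finset.setU11 // b'j mulr1; exact: nat_leDr.
    by apply: nat_le_trans (nat_leDl _ _ _) => //; exact: Nw.
  - rewrite finset.in_setU1 negb_or => /andP[kj kS].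
    rewrite [w' k]ffunE; apply: nat_le_meet => //.
      by rewrite (N_free k) //; exact: F_mono.
    apply: (nat_le_trans (F_mono w'u k)); apply: (nat_le_trans (F_affine _ _ wg)).
    rewrite ffunE; apply: nat_leD; first exact: wF.
    by rewrite -g_free ?finset.in_setU1 ?negb_or ?kj //; exact: nat_le_refl.
  - rewrite ffunE; apply: nat_le_meet => //; first exact: inf_pow_le1.
    by rewrite ffunE; apply: nat_le_trans (nat_leDl _ _ _).
have : N j <~ w j + N j * F g j.
  rewrite {1}(N_free j) //; apply: (nat_le_trans (F_mono Nu j)).
  apply: (nat_le_trans (F_affine _ _ wg)).
  by apply: nat_leD; [exact: wF|exact: nat_le_refl].
move/(le_add_mul_inf_pow K_absorptive K_continuous) => h.
by apply: (nat_le_trans h); apply: nat_leU => //; exact: nat_le_refl.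
Qed.

End GreatestFixedPoint.

End FrozenSystems.

(** * Both formulas for polynomial systems *)

Theorem theorem1 (K : comNzSemiRingType) (l : nat) (E : poly_system K l)
    (K_absorptive : absorptive K) (K_continuous : fully_continuous K) :
  is_lfp (@vec_le K l) (system_op E)
    (iter l (system_op E) [ffun=> 0]) /\
  is_gfp (@vec_le K l) (system_op E)
    (iter l (system_op E) (vec_inf_pow (iter l (system_op E) [ffun=> 1]))).
Proof.
move: (system_op_mono E K_absorptive) (system_op_affine E K_absorptive)
  (system_op_scale E K_absorptive) (system_op_inf_pow E K_absorptive K_continuous).
move: (system_op E) => F F_mono F_affine F_scale F_pow.
have vec_anti (x y : {ffun 'I_l -> K}) : vec_le x y -> vec_le y x -> x = y.
  by move=> xy yx; apply/ffunP => i; exact: nat_le_anti (xy i) (yx i).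
have vec0 (x : {ffun 'I_l -> K}) : vec_le [ffun=> 0] x.
  by move=> i; rewrite ffunE; exact: nat_le0.
have vec1 (x : {ffun 'I_l -> K}) : vec_le x [ffun=> 1].
  by move=> i; rewrite ffunE; exact: nat_le1.
have F_shift c (x : {ffun 'I_l -> K}) i : F [ffun k => x k + c] i <~ F x i + c.
  have -> : [ffun k => x k + c] = [ffun k => x k + c * [ffun=> 1] k].
    by apply/ffunP => k; rewrite !ffunE mulr1.
  apply: (nat_le_trans (F_affine _ _ _ _ (vec1 x))).
  by apply: nat_leD; [exact: nat_le_refl|exact: nat_leMl].
have iter_fix n y : F y = y -> iter n F y = y.
  by move=> Fy; elim: n => //= n ->.
split.
  split=> [|y Fy]; last by rewrite -(iter_fix l y Fy); exact: iter_mono.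
  apply: vec_anti; first exact: (iter_lfp K_absorptive F_mono F_shift l.+1).
  by rewrite -iterS iterSr; exact: iter_mono.
have [N gfpN] := freeze_gfp_exists K_absorptive F_mono K_continuous
  finset.set0 [ffun=> 1].
have F_fix : F N = N.
  by apply/ffunP => k; rewrite -(freeze_gfp_free gfpN) ?finset.in_set0.
have post_le y : vec_le y (F y) -> vec_le y N.
  by move=> yF; apply: (freeze_gfp_max gfpN) => k; rewrite ?finset.in_set0.
set v := vec_inf_pow _.
have vE : v = vec_inf_pow N.
  have vN : vec_le v N.
    have := @freeze_iter_inf_pow _ _ K_absorptive _ F_mono K_continuous
      F_scale F_pow l finset.set0 N.
    by rewrite card_free_set0 leqnn freeze0; exact.
  apply: vec_anti => k; rewrite !ffunE; last first.
    by apply: inf_pow_mono => //; rewrite -(iter_fix l N F_fix); exact: iter_mono.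
  by rewrite -inf_powK //; apply: inf_pow_mono => //; have := vN k; rewrite ffunE.
clearbody v.
have v_post : vec_le v (F v).
  by move=> k; rewrite vE [vec_inf_pow N k]ffunE -{1}F_fix; exact: F_pow.
have v_iter n : vec_le v (iter n F v).
  elim: n => [|n IH] k; first exact: nat_le_refl.
  by apply: (nat_le_trans (v_post k)); exact: F_mono.
set w := iter l F v.
have Fw : F w = w.
  apply: vec_anti; last by rewrite /w -iterS iterSr; exact: iter_mono.
  (* Iterating [G] from 0 imitates iterating [F] from [v], up to a shift by one: F^(l+1)(v) <=
     G^(l+2)(0) <= G^l(0) <= F^l(v). *)
  pose G (x : {ffun 'I_l -> K}) := [ffun k => v k + F x k].
  have G_mono x y : vec_le x y -> vec_le (G x) (G y).
    move=> xy k; rewrite !ffunE.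
    by apply: nat_leD; [exact: nat_le_refl|exact: F_mono].
  have G_shift c (x : {ffun 'I_l -> K}) i : G [ffun k => x k + c] i <~ G x i + c.
    by rewrite !ffunE -addrA; apply: nat_leD; [exact: nat_le_refl|exact: F_shift].
  have FG n : vec_le (iter n F v) (iter n.+1 G [ffun=> 0]).
    elim: n => [|n IH] k; rewrite [iter _ G _]/= ffunE.
      exact: nat_leDl.
    by apply: nat_le_trans (nat_leDr _ _ _) => //; exact: F_mono.
  have GF n : vec_le (iter n G [ffun=> 0]) (iter n F v).
    elim: n => [|n IH] k; first exact: vec0.
    by rewrite /= ffunE; apply: nat_leU; [exact: (v_iter n.+1)|exact: F_mono].
  move=> k; apply: nat_le_trans (GF l k).
  apply: nat_le_trans (iter_lfp K_absorptive G_mono G_shift l.+2 k).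
  exact: (FG l.+1).
have wN : vec_le w N by apply: post_le; rewrite Fw => k; exact: nat_le_refl.
suff -> : w = N by split=> // y Fy; apply: post_le; rewrite Fy => k; exact: nat_le_refl.
apply: vec_anti => //.
apply: (@freeze_gfp_le _ _ K_absorptive _ F_mono K_continuous F_affine F_scale
  l finset.set0) => // [||k|k|k].
- by rewrite card_free_set0.
- split=> [k|k _|y _ yF]; first by rewrite finset.in_set0.
    by rewrite F_fix.
  by apply: post_le => k; apply: yF; rewrite finset.in_set0.
- by rewrite finset.in_set0.
- by rewrite Fw => _; exact: nat_le_refl.
- by have := v_iter l k; rewrite {1}vE ffunE.
Qed.
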